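(* For every $2$-dimensional rectangle $R$ in $\mathbb{R}^2$ and every finite collection $\mathcal{S}$ of pairwise disjoint ($2$-dimensional) subrectangles of $R$, there is a finite minimal locally regulated partition $\mathcal{P}$ of $R$ with $\mathcal{S}\subseteq\mathcal{P}$. In contrast, for every $n\ge 3$ and every $n$-dimensional rectangle $R$ in $\mathbb{R}^n$, there exists a finite collection $\mathcal{S}$ of pairwise disjoint $n$-dimensional subrectangles of $R$ such that there does not exist any finite minimal locally regulated partition $\mathcal{P}$ of $R$ with $\mathcal{S}\subseteq\mathcal{P}$.
   Context: An $n$-dimensional rectangle in $\mathbb{R}^n$ is a set $[a_1,b_1]\times\cdots\times[a_n,b_n]$ with $a_i<b_i$ for all $i$; its interior $\mathrm{int}$ is $\prod_i(a_i,b_i)$. A locally regulated partition of an $n$-dimensional rectangle $R$ is a finite set $\mathcal{P}$ of $n$-dimensional rectangles with $\bigcup\mathcal{P}=R$ such that distinct elements of $\mathcal{P}$ have disjoint interiors. For $x\in\mathrm{int}(R)$: a standard unit vector $e_i$ is a boundary vector of $x$ with respect to $\mathcal{P}$ if there is $P=\prod_j[a_j,b_j]\in\mathcal{P}$ with $x\in P$ and $x_i\in\{a_i,b_i\}$; $\beta_{\mathcal{P}}(x)$ is the number of boundary vectors of $x$ with respect to $\mathcal{P}$; $\nu_{\mathcal{P}}(x)$ is the number of elements of $\mathcal{P}$ containing $x$. The locally regulated partition $\mathcal{P}$ of $R$ is minimal if $\nu_{\mathcal{P}}(x)=\beta_{\mathcal{P}}(x)+1$ for every $x\in\mathrm{int}(R)$.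 *)

(* Defs.v *)
From HB Require Import structures.
From mathcomp Require Import all_boot all_order all_algebra.
From mathcomp Require Import finmap.
From mathcomp Require Import boolp classical_sets reals.

Set Implicit Arguments.
Unset Strict Implicit.
Unset Printing Implicit Defensive.

Import Order.TTheory GRing.Theory Num.Theory.

Local Open Scope fset_scope.
Local Open Scope classical_set_scope.
Local Open Scope ring_scope.

(* An n-dimensional rectangle is encoded by its lower and upper corners, which
   the nondegeneracy condition makes unique. Hence Leibniz equality of
   rectangles is equality of the corresponding point sets. *)
Record rectangle (R : realType) (n : nat) := Rectangle {
  corners : 'rV[R]_n * 'rV[R]_n;
  corners_lt : [forall i, corners.1 ord0 i < corners.2 ord0 i] }.

HB.instance Definition _ (R : realType) (n : nat) :=
  [isSub for @corners R n].
HB.instance Definition _ (R : realType) (n : nat) :=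
  [Choice of rectangle R n by <:].

Definition lo (R : realType) (n : nat) (Q : rectangle R n) (i : 'I_n) : R :=
  (corners Q).1 ord0 i.

Definition hi (R : realType) (n : nat) (Q : rectangle R n) (i : 'I_n) : R :=
  (corners Q).2 ord0 i.

Definition rect_set (R : realType) (n : nat) (Q : rectangle R n) :
    set 'rV[R]_n :=
  [set x | forall i, lo Q i <= x ord0 i <= hi Q i].

Definition rect_int (R : realType) (n : nat) (Q : rectangle R n) :
    set 'rV[R]_n :=
  [set x | forall i, lo Q i < x ord0 i < hi Q i].

Definition locally_regulated_partition (R : realType) (n : nat)
    (A : rectangle R n) (P : {fset rectangle R n}) : Prop :=
  \bigcup_(Q in [set Q | Q \in P]) rect_set Q = rect_set A /\
  forall Q1 Q2, Q1 \in P -> Q2 \in P -> Q1 <> Q2 ->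
    rect_int Q1 `&` rect_int Q2 = set0.

(* The standard unit vector e_i is represented by its index i. *)
Definition boundary_vector (R : realType) (n : nat)
    (P : {fset rectangle R n}) (x : 'rV[R]_n) (i : 'I_n) : Prop :=
  exists Q, [/\ Q \in P, rect_set Q x & x ord0 i = lo Q i \/ x ord0 i = hi Q i].

Definition beta (R : realType) (n : nat)
    (P : {fset rectangle R n}) (x : 'rV[R]_n) : nat :=
  #|[pred i : 'I_n | `[< boundary_vector P x i >]]|.

Definition nu (R : realType) (n : nat)
    (P : {fset rectangle R n}) (x : 'rV[R]_n) : nat :=
  #|` [fset Q in P | `[< rect_set Q x >]] |.

Definition minimal_partition (R : realType) (n : nat)
    (A : rectangle R n) (P : {fset rectangle R n}) : Prop :=
  locally_regulated_partition A P /\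
  forall x, rect_int A x -> nu P x = (beta P x + 1)%N.

(* Disjointness is that of the closed rectangles, not of their interiors. *)
Definition disjoint_subrectangles (R : realType) (n : nat)
    (A : rectangle R n) (S : {fset rectangle R n}) : Prop :=
  (forall Q, Q \in S -> rect_set Q `<=` rect_set A) /\
  forall Q1 Q2, Q1 \in S -> Q2 \in S -> Q1 <> Q2 ->
    rect_set Q1 `&` rect_set Q2 = set0.

(* Main.v *)
Require Import Defs.
From mathcomp Require Import all_boot all_order all_algebra.
From mathcomp Require Import finmap.
From mathcomp Require Import boolp classical_sets reals.
From mathcomp Require Import lra.

(** In the plane, a partition is minimal at an interior point exactly when the
    point is not a crossing, that is, a point where four members of the
    partition have a corner ([minimal_criterion] is the direction that is
    needed). Given a finite set S of disjoint rectangles, cut the rest of the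
    big rectangle along every vertical line through a vertical side of a member
    of S, and add the vertically maximal free pieces of the resulting strips
    ([filler]). All horizontal edges of the partition are then contained in
    horizontal sides of members of S, or in the boundary of the big rectangle.
    A crossing would have one horizontal edge on its left and one on its right,
    in sides of members of S which both contain the point; as S is disjoint,
    these are the same member, and the point is in the relative interior of one
    of its sides, hence no crossing ([partition_extends]).

    In dimension n >= 3, S consists of three rods X, Y, Z, each as long as the
    big rectangle in its own direction (and in all directions other than the
    first three), with Y above X and Z on the right of X. Let P be a minimal
    partition that contains S, and fix generic values of the coordinates after
    the third. On this slice beta is at most 3, so at most four members of P
    meet at a point, and this is all that the argument uses. The slice is a
    [brick_family].

    Consider the walls that extend over the full length in the x direction: a
    horizontal wall at height h near y = b consists of lines in the x direction
    at height h, with y close to b, none of which enters the interior of a brick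
    ([zwall]). Suppose that a horizontal wall ends at y = b, because some brick
    on the right of b has h strictly inside its z range. Then the plane y = b
    does not enter the interior of a brick just above and just below h, for all
    x ([wall_end]): otherwise, at the value of x where the bricks that block
    the wall stop, three fourths of the horizontal plane near the point would
    consist of faces, and five bricks would meet there ([abuts_step]). So a
    horizontal wall that ends produces a vertical one, and conversely.

    The top of X is a horizontal wall below Y and on the left of Z. Take the
    highest such wall below Y. It cannot cross Z, so it ends on its right before
    Z, and a vertical wall starts there and goes up. The latter cannot cross Y,
    so it ends below Y at a horizontal wall higher than the first one, which is
    absurd ([rods_false]). *)

Set Implicit Arguments.
Unset Strict Implicit.
Unset Printing Implicit Defensive.

Import Order.TTheory GRing.Theory Num.Theory.

Local Open Scope fset_scope.
Local Open Scope classical_set_scope.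
Local Open Scope ring_scope.

(** * Finite sequences and sets *)

Lemma ex_maximal (R : realType) (T : eqType) (f : T -> R) (s : seq T)
    (P : T -> Prop) t0 : t0 \in s -> P t0 ->
  exists t, [/\ t \in s, P t & forall u, u \in s -> P u -> f u <= f t].
Proof.
elim: s t0 => [//|a s IHs] t0 t0s Pt0.
have [[u [us Pu]]|noP] := pselect (exists u, u \in s /\ P u); last first.
  have Pa : P a.
    by move: t0s; rewrite in_cons => /orP[/eqP <- //|t0s]; case: noP; exists t0.
  exists a; split=> // [|u]; first exact: mem_head.
  by rewrite in_cons => /orP[/eqP ->//|us Pu]; case: noP; exists u.
have [m [ms Pm maxm]] := IHs u us Pu.
have [[Pa ltma]|noa] := pselect (P a /\ f m < f a).
  exists a; split=> // [|v]; first exact: mem_head.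
  rewrite in_cons => /orP[/eqP ->//|vs Pv].
  exact: le_trans (maxm v vs Pv) (ltW ltma).
exists m; split=> // [|v]; first by rewrite in_cons ms orbT.
rewrite in_cons => /orP[/eqP ->|vs Pv]; last exact: maxm.
by move=> Pa; rewrite leNgt; apply/negP => ?; apply: noa.
Qed.

Lemma ex_minimal (R : realType) (T : eqType) (f : T -> R) (s : seq T)
    (P : T -> Prop) t0 : t0 \in s -> P t0 ->
  exists t, [/\ t \in s, P t & forall u, u \in s -> P u -> f t <= f u].
Proof.
move=> t0s Pt0; have [t [ts Pt maxt]] := ex_maximal (fun u => - f u) t0s Pt0.
by exists t; split=> // u us Pu; rewrite -lerN2; apply: maxt.
Qed.

Lemma in_fset3 (K : choiceType) (a b c x : K) :
  x \in [fset a; b; c] -> [\/ x = a, x = b | x = c].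
Proof.
by rewrite !inE -orbA => /or3P[] /eqP ->; [apply: Or31|apply: Or32|apply: Or33].
Qed.

Lemma fset3_in (K : choiceType) (a b c : K) :
  [/\ a \in [fset a; b; c], b \in [fset a; b; c] & c \in [fset a; b; c]].
Proof. by rewrite !inE !eqxx !orbT. Qed.

Lemma card_fset3 (K : choiceType) (a b c : K) : a != b -> a != c ->
  #|` [fset a; b; c] | = (2 + (b != c))%N.
Proof.
move=> ab ac; rewrite -fsetUA cardfsU1 cardfs2 !inE (negPf ab) (negPf ac).
by [].
Qed.

Lemma fset_filter_eq (K : choiceType) (P B : {fset K}) (p : pred K) :
  (forall x, x \in P -> p x -> x \in B) ->
  (forall x, x \in B -> x \in P /\ p x) -> [fset x in P | p x] = B.
Proof.
move=> PB BP; apply/fsetP => x; rewrite !inE; apply/andP/idP => [[]|/BP[]//].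
exact: PB.
Qed.

Lemma in_fset_filter (K : choiceType) (B : {fset K}) (p : pred K) x :
  (x \in [fset y in B | p y]) = (x \in B) && p x.
Proof. by rewrite !inE. Qed.

(** * Walls in a family of bricks *)

(** The interval from l to r contains p and the points close to p on its right
    (s = true), respectively on its left (s = false). *)
Definition beside (R : realType) (s : bool) (l r p : R) : bool :=
  if s then (l <= p) && (p < r) else (l < p) && (p <= r).

Lemma beside_both (R : realType) (s : bool) (l r p : R) :
  beside (~~ s) l r p -> beside s l r p -> l < p < r.
Proof. by case: s => /= /andP[? ?] /andP[? ?]; apply/andP. Qed.

Lemma beside_in (R : realType) (s : bool) (l r p : R) :
  beside s l r p -> l <= p <= r.
Proof. by case: s => /andP[? ?]; apply/andP; split=> //; apply: ltW. Qed.

(** A finite family of boxes in a box of R^3, with coordinates x, y, z. For t in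
    the family, xl t and xr t are the ends of the x range of t, and similarly
    for y and z. The boxes cover the interior of the big one ([brick_beside]
    gives a box on every side of every point), have disjoint interiors, and at
    most four of them meet at an interior point. *)
Record brick_family (R : realType) := BrickFamily {
  brick :> finType;
  xl : brick -> R; xr : brick -> R;
  yl : brick -> R; yr : brick -> R;
  zl : brick -> R; zr : brick -> R;
  xlo : R; xhi : R; ylo : R; yhi : R; zlo : R; zhi : R;
  brick_lt : forall t, [/\ xl t < xr t, yl t < yr t & zl t < zr t];
  brick_sub : forall t, [/\ xlo <= xl t /\ xr t <= xhi,
    ylo <= yl t /\ yr t <= yhi & zlo <= zl t /\ zr t <= zhi];
  brick_beside : forall x y z sx sy sz,
    xlo < x < xhi -> ylo < y < yhi -> zlo < z < zhi ->
    exists t, [/\ beside sx (xl t) (xr t) x, beside sy (yl t) (yr t) y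
                & beside sz (zl t) (zr t) z];
  brick_overlap : forall t u,
    xl t < xr u -> xl u < xr t -> yl t < yr u -> yl u < yr t ->
    zl t < zr u -> zl u < zr t -> t = u;
  brick_le4 : forall x y z (s : seq brick),
    xlo < x < xhi -> ylo < y < yhi -> zlo < z < zhi -> uniq s ->
    (forall t, t \in s -> [/\ xl t <= x <= xr t, yl t <= y <= yr t
                            & zl t <= z <= zr t]) ->
    (size s <= 4)%N }.

(** The same family with the roles of y and z exchanged. *)
Definition swap_yz (R : realType) (F : brick_family R) : brick_family R.
Proof.
refine (@BrickFamily R (brick F) (@xl _ F) (@xr _ F) (@zl _ F) (@zr _ F)
  (@yl _ F) (@yr _ F) (xlo F) (xhi F) (zlo F) (zhi F) (ylo F) (yhi F) _ _ _ _ _).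
- by move=> t; case: (brick_lt t).
- by move=> t; case: (brick_sub t).
- move=> x y z sx sy sz hx hy hz.
  by have [t [? ? ?]] := brick_beside sx sz sy hx hz hy; exists t.
- by move=> t u *; apply: brick_overlap.
- move=> x y z s hx hy hz us hs; apply: (brick_le4 hx hz hy us) => t /hs.
  by case.
Defined.

Section Walls.
Variables (R : realType) (F : brick_family R).
Implicit Types (t u : F) (h b : R).

(** For all x, the points (x, y, h) with y close to b on the side s of b are not
    interior to a brick. Exchanging y and z, zwall (swap_yz F) b h s is the same
    property of the points (x, b, z) with z close to h on the side s of h. *)
Definition zwall h b (s : bool) : Prop :=
  forall t, beside s (yl t) (yr t) b -> ~~ (zl t < h < zr t).

(** The brick t has its left face in the plane y = b, and h is strictly inside
    its z range: it blocks a wall at height h coming from the left. *)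
Definition abuts h b t := (yl t == b) && (zl t < h < zr t).

(** The bricks that block a horizontal wall continue one another in the x
    direction: beyond each of the two ends p of the x range of such a brick t
    there is another one. Otherwise five bricks meet at (p, b, h): t, two bricks
    on the left of b, and two on its right beyond p, above and below h. *)
Lemma abuts_step h b s t :
  zlo F < h < zhi F -> ylo F < b < yhi F -> zwall h b false -> abuts h b t ->
  let p := if s then xr t else xl t in
  xlo F < p < xhi F ->
  exists2 u, abuts h b u & beside s (xl u) (xr u) p.
Proof.
move=> hz hy wall tG p hx; apply: contrapT => nov.
have abutsN u : beside s (xl u) (xr u) p -> ~~ abuts h b u.
  by move=> pu; apply/negP => gu; apply: nov; exists u.
have [u1 [x1 y1 z1]] := brick_beside (~~ s) false true hx hy hz.
have [u2 [x2 y2 z2]] := brick_beside (~~ s) false false hx hy hz.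
have [v1 [x3 y3 z3]] := brick_beside s true true hx hy hz.
have [v2 [x4 y4 z4]] := brick_beside s true false hx hy hz.
have w1 := wall _ y1; have w2 := wall _ y2.
case/andP: tG => /eqP ty /andP[tz1 tz2].
have [tx ty2 _] := brick_lt t.
rewrite /= in y1 y2 y3 y4 z1 z2 z3 z4.
(* The horizontal wall separates u1 from u2 and, as no brick abuts beyond p, v1
   from v2. *)
have zu1 : zl u1 = h by lra.
have zu2 : zr u2 = h by lra.
clear w1 w2.
have right_z (v : F) : beside s (xl v) (xr v) p -> yl v <= b < yr v ->
    ~~ (zl v < h < zr v).
  move=> vx; have := abutsN v vx; rewrite /abuts negb_and.
  move=> /orP[ylb /andP[yb yb']|//].
  by apply: wall; rewrite /= lt_neqAle ylb yb ltW.
have zv1 : zl v1 = h by have := right_z _ x3 y3; lra.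
have zv2 : zr v2 = h by have := right_z _ x4 y4; lra.
have inxt : xl t <= p <= xr t by rewrite /p; case: (s); rewrite lexx (ltW tx).
(* A brick on the left of b before p and one on the right of b beyond p, if
   equal, would overlap t. *)
have cross (u v : F) : beside (~~ s) (xl u) (xr u) p ->
    beside s (xl v) (xr v) p -> yl u < b <= yr u -> yl v <= b < yr v ->
    zl u < zr t -> zl t < zr u -> t != u -> u != v.
  move=> xu xv yu yv zu zu' tu; apply: contra tu => /eqP uv; apply/eqP.
  rewrite -{}uv in xv yv; have /andP[px px'] := beside_both xu xv.
  case/andP: inxt => tp tp'; case/andP: yu => yu _; case/andP: yv => _ yv.
  apply: brick_overlap; rewrite ?zu ?zu' //.
  - exact: le_lt_trans tp px'.
  - exact: lt_le_trans px tp'.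
  - by rewrite ty.
  - by apply: lt_trans yu _; rewrite -ty.
have tl (v : F) : zl v = h -> t != v.
  by move=> zv; apply/eqP => e; rewrite e zv ltxx in tz1.
have tr (v : F) : zr v = h -> t != v.
  by move=> zv; apply/eqP => e; rewrite e zv ltxx in tz2.
have lr (v v' : F) : zl v = h -> zr v' = h -> v != v'.
  move=> zv zv'; apply/eqP => e; have [_ _] := brick_lt v.
  by rewrite zv e zv' ltxx.
suff : (size [:: t; u1; v1; u2; v2] <= 4)%N by [].
apply: (brick_le4 hx hy hz).
  rewrite /= !inE !negb_or !andbT (tl u1) // (tl v1) // (tr u2) // (tr v2) //=.
  rewrite (lr u1 u2) // (lr u1 v2) // (lr v1 v2) // (eq_sym v1 u2).
  have -> : u1 != v1 by apply: cross x1 x3 y1 y3 _ _ (tl _ zu1); lra.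
  have -> : u2 != v2 by apply: cross x2 x4 y2 y4 _ _ (tr _ zu2); lra.
  by rewrite eq_sym (lr v1 u2).
move=> v; rewrite !inE => /or4P[/eqP ->|/eqP ->|/eqP ->|/orP[] /eqP ->].
- by split=> //; [rewrite ty lexx -ty ltW|rewrite !ltW].
- by split; [exact: beside_in x1|exact: (beside_in (s:=false) y1)
            |exact: (beside_in (s:=true) z1)].
- by split; [exact: beside_in x3|exact: (beside_in (s:=true) y3)
            |exact: (beside_in (s:=true) z3)].
- by split; [exact: beside_in x2|exact: (beside_in (s:=false) y2)
            |exact: (beside_in (s:=false) z2)].
- by split; [exact: beside_in x4|exact: (beside_in (s:=true) y4)
            |exact: (beside_in (s:=false) z4)].
Qed.

(** A horizontal wall that ends somewhere along y = b ends there for all x. *)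
Lemma abuts_cover h b t x :
  zlo F < h < zhi F -> ylo F < b < yhi F -> zwall h b false -> abuts h b t ->
  xlo F < x < xhi F ->
  exists2 u, abuts h b u & xl u <= x <= xr u.
Proof.
move=> hz hy wall tG hx.
have [xt|tx] := leP (xl t) x.
  have [g [_ [gG gx] maxg]] := ex_maximal (@xr _ F)
    (P := fun u => abuts h b u /\ xl u <= x) (mem_enum F t) (conj tG xt).
  exists g => //; rewrite gx /= leNgt; apply/negP => ltx.
  have [lt_g _ _] := brick_lt g; have [[lo_g _] _ _] := brick_sub g.
  have [|u uG /andP[ux xu]] := @abuts_step h b true g hz hy wall gG.
    by lra.
  by have := maxg u (mem_enum _ _) (conj uG (ltW (le_lt_trans ux ltx))); lra.
have [lt_t _ _] := brick_lt t.
have xt : x <= xr t by lra.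
have [g [_ [gG gx] ming]] := ex_minimal (@xl _ F)
  (P := fun u => abuts h b u /\ x <= xr u) (mem_enum F t) (conj tG xt).
exists g => //; rewrite gx andbT leNgt; apply/negP => ltx.
have [lt_g _ _] := brick_lt g; have [[_ hi_g] _ _] := brick_sub g.
have [|u uG /andP[ux xu]] := @abuts_step h b false g hz hy wall gG.
  by lra.
by have := ming u (mem_enum _ _) (conj uG (ltW (lt_le_trans ltx xu))); lra.
Qed.

End Walls.

(** If the horizontal wall at height h, coming from the left, is blocked at y = b
    by some brick, then there is a vertical wall in y = b above and below h. *)
Lemma wall_end (R : realType) (F : brick_family R) h b (t0 : F) s :
  zlo F < h < zhi F -> ylo F < b < yhi F -> zwall F h b false ->
  yl t0 <= b < yr t0 -> zl t0 < h < zr t0 ->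
  zwall (swap_yz F) b h s.
Proof.
move=> hz hy wall yt0 zt0 t /= zt; apply/negP => yt.
have G0 : abuts h b t0.
  rewrite /abuts zt0 andbT; apply: contraTT zt0 => nb.
  by apply: wall => /=; rewrite lt_neqAle nb; case/andP: yt0 => -> /ltW ->.
have [tx _ _] := brick_lt t; have [[sx1 sx2] _ _] := brick_sub t.
have [|g /andP[/eqP yg zg] xg] := @abuts_cover _ F h b t0 ((xl t + xr t) / 2) hz hy wall G0.
  by lra.
have [_ gy _] := brick_lt g.
have e : t = g by apply: brick_overlap; case: s zt => /= zt; lra.
by rewrite e yg in yt; lra.
Qed.

Section Advance.
Variables (R : realType) (F : brick_family R).

(** The ends of the y ranges of all bricks. *)
Definition yends : seq R := map (@yl R F) (enum F) ++ map (@yr R F) (enum F).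

Lemma yl_ends (t : F) : yl t \in yends.
Proof. by rewrite mem_cat map_f ?mem_enum. Qed.

Lemma yr_ends (t : F) : yr t \in yends.
Proof. by rewrite mem_cat orbC map_f ?mem_enum. Qed.

(** A wall just after b extends up to the next end of a y range. *)
Lemma zwall_next h b c : c \in yends -> b < c -> zwall F h b true ->
  exists b', [/\ b' \in yends, b < b' <= c & zwall F h b' false].
Proof.
move=> cy bc wall; have [b' [b'y bb' minb]] := ex_minimal id (P := fun y => b < y) cy bc.
exists b'; split=> //; first by rewrite bb' minb.
move=> t /= /andP[tb' b't]; apply: wall => /=; rewrite (lt_le_trans bb' b't) andbT.
by rewrite leNgt; apply/negP => /(minb _ (yl_ends t)); rewrite leNgt tb'.
Qed.

(** A wall at height h that has a brick s in its way is blocked, at the latest by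
    s. *)
Lemma zwall_advance h b (s : F) : b \in yends -> b <= yl s -> zl s < h < zr s ->
  zwall F h b false ->
  exists b' (t : F), [/\ b' \in yends, b <= b' <= yl s, zwall F h b' false,
                   yl t <= b' < yr t & zl t < h < zr t].
Proof.
move=> by_ bs sh wall.
have [b' [b'y [bb' wall'] maxb]] := ex_maximal id
  (P := fun y => b <= y <= yl s /\ zwall F h y false) by_
  (conj (introT andP (conj (lexx b) bs)) wall).
exists b'; apply: contrapT => nobt.
have wallr : zwall F h b' true.
  by move=> t yt; apply/negP => zt; apply: nobt; exists t.
have [b's|sb'|b's] := ltgtP b' (yl s).
- have [b2 [b2y /andP[lt_b2 b2s] wall2]] := zwall_next (yl_ends s) b's wallr.
  suff : b2 <= b' by rewrite leNgt lt_b2.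
  by apply: maxb => //; split=> //; case/andP: bb' => bb' _; lra.
- by case/andP: bb' => _; rewrite leNgt sb'.
- have [_ lt_s _] := brick_lt s.
  by apply: nobt; exists s; split=> //; rewrite b's lexx.
Qed.

End Advance.

(** Three mutually skew rods of full length, with Y above X and Z on the right of
    X, cannot belong to a family of bricks. *)
Lemma rods_false (R : realType) (F : brick_family R) (X Y Z : F) :
  xl X = xlo F -> xr X = xhi F -> yl Y = ylo F -> yr Y = yhi F ->
  zl Z = zlo F -> zr Z = zhi F -> yr X <= yl Z -> zr X <= zl Y -> False.
Proof.
move=> Xl Xr Yl Yr Zl Zr XZ XY.
have [ltXx ltXy ltXz] := brick_lt X; have [_ [Xy Xy'] [Xz Xz']] := brick_sub X.
have [ltYx ltYy ltYz] := brick_lt Y; have [_ _ [Yz Yz']] := brick_sub Y.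
have [ltZx ltZy ltZz] := brick_lt Z; have [_ [Zy Zy'] _] := brick_sub Z.
(* The heights of the horizontal walls between X and Y, on the left of Z. *)
pose P h := zr X <= h <= zl Y /\
  exists b, [/\ b \in yends F, yr X <= b <= yl Z & zwall F h b false].
have P0 : P (zr X).
  split; first by rewrite lexx XY.
  exists (yr X); split; [exact: yr_ends|by rewrite lexx XZ|].
  (* A brick crossing the top of X near its right edge would overlap X. *)
  move=> t /= yt; apply/negP => zt.
  have [tx _ _] := brick_lt t; have [[? ?] _ _] := brick_sub t.
  have e : t = X by apply: brick_overlap; lra.
  by rewrite e in zt; lra.
have [h [hz [hX [b [b_y bX wall]]] maxh]] :=
  ex_maximal id (P := P) (yr_ends (X : swap_yz F)) P0.
have Zh : zl Z < h < zr Z by rewrite Zl Zr; lra.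
have bZ : b <= yl Z by case/andP: bX.
have [b1 [t [b1y bb1 wall1 yt zt]]] := zwall_advance b_y bZ Zh wall.
have hb : zlo F < h < zhi F by lra.
have b1b : ylo F < b1 < yhi F by lra.
have Yb1 : yl Y < b1 < yr Y by rewrite Yl Yr.
have vwall := wall_end (s := true) hb b1b wall1 yt zt.
have hY : h < zl Y.
  rewrite lt_neqAle; case/andP: hX => _ ->; rewrite andbT; apply/eqP => e.
  have Yh : beside true (zl Y) (zr Y) h by rewrite /= e lexx.
  by have := vwall Y Yh; rewrite /= Yb1.
have [e [e_z /andP[he eY] ewall]] := zwall_next (yl_ends (Y : swap_yz F)) hY vwall.
have [e1 [u [e1z ee1 wall2 zu yu]]] :=
  @zwall_advance R (swap_yz F) b1 e Y e_z eY Yb1 ewall.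
have e1b : zlo F < e1 < zhi F by move: (ee1) => /=; lra.
have wall3 := @wall_end R (swap_yz F) b1 e1 u false b1b e1b wall2 zu yu.
suff : e1 <= h by move: (ee1) => /=; lra.
apply: maxh => //; split; first by move: (ee1) => /=; lra.
by exists b1; split=> //; lra.
Qed.

(** * Rectangles and their sides *)

Section Rectangles.
Variables (R : realType) (n : nat).
Implicit Types (Q A : rectangle R n) (P : {fset rectangle R n}).

Lemma lo_lt_hi Q i : lo Q i < hi Q i.
Proof. exact: (forallP (corners_lt Q)). Qed.

Lemma rectangle_eq Q1 Q2 :
  (forall i, lo Q1 i = lo Q2 i /\ hi Q1 i = hi Q2 i) -> Q1 = Q2.
Proof.
move=> eqQ; apply: val_inj; rewrite /=.
rewrite [corners Q1]surjective_pairing [corners Q2]surjective_pairing.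
by congr pair; apply/rowP => i; rewrite -?/(lo _ _) -?/(hi _ _); case: (eqQ i).
Qed.

Lemma box_subproof (l h : 'I_n -> R) : (forall i, l i < h i) ->
  [forall i, (\row_j l j, \row_j h j).1 ord0 i
             < (\row_j l j, \row_j h j).2 ord0 i :> R].
Proof. by move=> lh; apply/forallP => i; rewrite !mxE. Qed.

(** The rectangle of lower corner l and upper corner h. *)
Definition box (l h : 'I_n -> R) (lh : forall i, l i < h i) : rectangle R n :=
  Rectangle (box_subproof lh).

Lemma lo_box l h lh i : lo (@box l h lh) i = l i.
Proof. by rewrite /lo mxE. Qed.

Lemma hi_box l h lh i : hi (@box l h lh) i = h i.
Proof. by rewrite /hi mxE. Qed.

Lemma rect_sub Q A : rect_set Q `<=` rect_set A ->
  forall i, lo A i <= lo Q i /\ hi Q i <= hi A i.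
Proof.
move=> QA i.
have /QA/(_ i) : rect_set Q (corners Q).1.
  by move=> j; apply/andP; split; [exact: lexx|exact: ltW (lo_lt_hi Q j)].
have /QA/(_ i) : rect_set Q (corners Q).2.
  by move=> j; apply/andP; split; [exact: ltW (lo_lt_hi Q j)|exact: lexx].
by move=> /andP[_ ?] /andP[? _]; split.
Qed.

Lemma rect_int_meet Q1 Q2 :
  (forall i, lo Q1 i < hi Q2 i /\ lo Q2 i < hi Q1 i) ->
  rect_int Q1 `&` rect_int Q2 !=set0.
Proof.
move=> meet.
exists (\row_i ((Num.max (lo Q1 i) (lo Q2 i) + Num.min (hi Q1 i) (hi Q2 i)) / 2)).
have mid i : Num.max (lo Q1 i) (lo Q2 i) < Num.min (hi Q1 i) (hi Q2 i).
  have [? ?] := meet i.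
  by rewrite lt_min !gt_max !lo_lt_hi andbT /=; apply/andP; split.
by split=> i; rewrite mxE; have := mid i;
  case: (lerP (lo Q1 i) (lo Q2 i)) => ?; case: (lerP (hi Q1 i) (hi Q2 i)) => ? ?; lra.
Qed.

Lemma ex_avoid (s : seq R) (a b : R) : a < b ->
  exists2 w, a < w < b & w \notin s.
Proof.
elim: s a b => [|r s IHs] a b ab; first by exists ((a + b) / 2) => //; lra.
have [rm|mr] := leP r ((a + b) / 2).
  have [|w wab ws] := IHs ((a + b) / 2) b; first by lra.
  by exists w; [lra|rewrite in_cons negb_or ws andbT; apply/eqP; lra].
have [|w wab ws] := IHs a ((a + b) / 2); first by lra.
by exists w; [lra|rewrite in_cons negb_or ws andbT; apply/eqP; lra].
Qed.

(** The nonzero members of a finite set of reals are bounded away from 0. *)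
Lemma ex_gap (s : seq R) : exists2 e : R, 0 < e &
  forall r, r \in s -> r != 0 -> e <= `|r|.
Proof.
elim: s => [|r s [e e0 es]]; first by exists 1.
have [->|r0] := eqVneq r 0.
  by exists e => // q; rewrite in_cons => /orP[/eqP ->|/es//]; rewrite eqxx.
exists (Num.min e `|r|); first by rewrite lt_min e0 normr_gt0.
move=> q; rewrite in_cons => /orP[/eqP -> _|/es es' q0]; rewrite ge_min ?lexx ?orbT //.
by rewrite es'.
Qed.

(** The point p moved by d in each coordinate: upwards in the coordinates i such
    that s i, downwards in the others. *)
Definition nudge (p : 'rV[R]_n) (s : 'I_n -> bool) (d : R) : 'rV[R]_n :=
  \row_i (p ord0 i + (-1) ^+ (~~ s i) * d).

(** Q contains p and the points close to p in the orthant at p of sign vector s. *)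
Definition rect_beside Q (p : 'rV[R]_n) (s : 'I_n -> bool) : Prop :=
  forall i, beside (s i) (lo Q i) (hi Q i) (p ord0 i).

Lemma rect_besideW Q p s : rect_beside Q p s -> rect_set Q p.
Proof. by move=> Qp i; apply: beside_in (Qp i). Qed.

Lemma rect_beside_ex Q p : rect_set Q p -> exists s, rect_beside Q p s.
Proof.
move=> Qp; exists (fun i => p ord0 i < hi Q i) => i.
case/andP: (Qp i) => lp ph; rewrite /beside.
case: ltP => [ltp|lep]; first by rewrite lp.
by rewrite ph andbT (lt_le_trans (lo_lt_hi Q i)).
Qed.

Lemma rect_beside_meet Q1 Q2 p s : rect_beside Q1 p s -> rect_beside Q2 p s ->
  rect_int Q1 `&` rect_int Q2 !=set0.
Proof.
move=> h1 h2; apply: rect_int_meet => i; move: (h1 i) (h2 i); rewrite /beside.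
by case: (s i) => /andP[? ?] /andP[? ?]; split; lra.
Qed.

(** The coordinates of the faces of the members of P, relative to those of p. *)
Definition offsets P (p : 'rV[R]_n) : seq R :=
  [seq lo Q i - p ord0 i | Q <- P, i <- enum 'I_n] ++
  [seq hi Q i - p ord0 i | Q <- P, i <- enum 'I_n].

Lemma lo_offsets P (p : 'rV[R]_n) Q i : Q \in P -> lo Q i - p ord0 i \in offsets P p.
Proof.
move=> QP; rewrite mem_cat; apply/orP; left; apply/allpairsP.
by exists (Q, i); rewrite mem_enum.
Qed.

Lemma hi_offsets P (p : 'rV[R]_n) Q i : Q \in P -> hi Q i - p ord0 i \in offsets P p.
Proof.
move=> QP; rewrite mem_cat; apply/orP; right; apply/allpairsP.
by exists (Q, i); rewrite mem_enum.
Qed.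

(** As P is finite, a member of P that contains points of the orthant arbitrarily
    close to p contains all of them near p. *)
Lemma rect_beside_cover P p s :
  (forall e, 0 < e -> exists d Q,
     [/\ 0 < d < e, Q \in P & rect_set Q (nudge p s d)]) ->
  exists2 Q, Q \in P & rect_beside Q p s.
Proof.
move=> near; have [e e0 gap] := ex_gap (offsets P p).
have [d [Q [/andP[d0 de] QP Qd]]] := near e e0.
exists Q => // i; have := Qd i; rewrite mxE => /andP[lop phi].
have glo : lo Q i - p ord0 i != 0 -> e <= `|lo Q i - p ord0 i|.
  exact: gap (lo_offsets _ _ QP).
have ghi : hi Q i - p ord0 i != 0 -> e <= `|hi Q i - p ord0 i|.
  exact: gap (hi_offsets _ _ QP).
have ltlh := lo_lt_hi Q i.
rewrite /beside; case: (s i) lop phi => /=; rewrite ?expr0 ?expr1 => lop phi.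
  apply/andP; split.
    rewrite leNgt; apply/negP => plo.
    by have := glo _; rewrite gtr0_norm; [move=> H; have := H _; lra|lra].
  lra.
apply/andP; split; first by lra.
rewrite leNgt; apply/negP => plo.
have := ghi _; rewrite ltr0_norm; [move=> H; have := H _; lra|lra].
Qed.

Lemma nudge_int A p (s : 'I_n -> bool) : rect_set A p ->
  (forall i, s i -> p ord0 i < hi A i) -> (forall i, ~~ s i -> lo A i < p ord0 i) ->
  exists2 e, 0 < e & forall d, 0 < d < e -> rect_int A (nudge p s d).
Proof.
move=> Ap sT sF; have [e e0 gap] := ex_gap (offsets [fset A] p).
exists e => // d /andP[d0 de] i; have /andP[lop phi] := Ap i; rewrite mxE.
have glo : lo A i - p ord0 i != 0 -> e <= `|lo A i - p ord0 i|.
  exact: gap (lo_offsets _ _ (fset11 A)).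
have ghi : hi A i - p ord0 i != 0 -> e <= `|hi A i - p ord0 i|.
  exact: gap (hi_offsets _ _ (fset11 A)).
case: (boolP (s i)) => [/sT|/sF] ltp /=; rewrite ?expr0 ?expr1.
  by move: ghi; rewrite gtr0_norm ?subr_gt0 // => H; have := H _; lra.
by move: glo; rewrite ltr0_norm ?subr_lt0 // => H; have := H _; lra.
Qed.

End Rectangles.

(** * Three rods in dimension at least three *)

(** The members of a minimal partition that meet a generic 3-dimensional slice,
    parallel to the coordinates i0, i1, i2, form a family of bricks. Rectangles
    of full length in the other directions meet every slice. *)
Lemma slice_bricks (R : realType) n (i0 i1 i2 : 'I_n) (A : rectangle R n)
    (P : {fset rectangle R n}) :
  i0 != i1 -> i0 != i2 -> i1 != i2 -> minimal_partition A P ->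
  exists F : brick_family R,
    [/\ xlo F = lo A i0 /\ xhi F = hi A i0, ylo F = lo A i1 /\ yhi F = hi A i1,
        zlo F = lo A i2 /\ zhi F = hi A i2 &
    forall Q, Q \in P ->
      (forall j, j \notin [:: i0; i1; i2] -> lo Q j = lo A j /\ hi Q j = hi A j) ->
      exists t : F, [/\ xl t = lo Q i0 /\ xr t = hi Q i0,
                        yl t = lo Q i1 /\ yr t = hi Q i1
                      & zl t = lo Q i2 /\ zr t = hi Q i2]].
Proof.
move=> i01 i02 i12 [[covP disjP] minP].
pose ends := [seq lo Q j | Q <- P, j <- enum 'I_n] ++
             [seq hi Q j | Q <- P, j <- enum 'I_n].
have loE Q j : Q \in P -> lo Q j \in ends.
  move=> QP; rewrite mem_cat; apply/orP; left; apply/allpairsP.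
  by exists (Q, j); rewrite mem_enum.
have hiE Q j : Q \in P -> hi Q j \in ends.
  move=> QP; rewrite mem_cat; apply/orP; right; apply/allpairsP.
  by exists (Q, j); rewrite mem_enum.
(* The value w j of the coordinate j is not that of a face of a member of P, so
   that j is not a boundary vector at a point of the slice. *)
have avoid j : exists r : R, lo A j < r < hi A j /\ r \notin ends.
  by have [r rA re] := ex_avoid ends (lo_lt_hi A j); exists r.
have [w wP] := choice avoid.
have subP Q : Q \in P -> forall i, lo A i <= lo Q i /\ hi Q i <= hi A i.
  move=> QP; apply: rect_sub => x Qx; rewrite -covP.
  by exists Q.
pose is3 j := j \in [:: i0; i1; i2].
pose D := [fset Q in P | [forall j, is3 j || (lo Q j < w j < hi Q j)]].
have DP Q : Q \in D -> Q \in P.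
  by rewrite !inE => /andP[].
have Dw Q j : Q \in D -> ~~ is3 j -> lo Q j < w j < hi Q j.
  by rewrite !inE => /andP[_ /forallP/(_ j)/orP[->|]].
pose pt (x y z : R) : 'rV[R]_n := \row_j
  (if j == i0 then x else if j == i1 then y else if j == i2 then z else w j).
have pt0 x y z : pt x y z ord0 i0 = x by rewrite mxE eqxx.
have pt1 x y z : pt x y z ord0 i1 = y by rewrite mxE eq_sym (negPf i01) eqxx.
have pt2 x y z : pt x y z ord0 i2 = z.
  by rewrite mxE eq_sym (negPf i02) eq_sym (negPf i12) eqxx.
have ptw x y z j : ~~ is3 j -> pt x y z ord0 j = w j.
  by rewrite /is3 !inE !negb_or mxE => /and3P[/negPf -> /negPf -> /negPf ->].
have is3P j : is3 j -> [\/ j = i0, j = i1 | j = i2].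
  by rewrite /is3 !inE => /or3P[] /eqP ->; [apply: Or31|apply: Or32|apply: Or33].
have pt_in Q x y z : Q \in D -> lo Q i0 <= x <= hi Q i0 ->
    lo Q i1 <= y <= hi Q i1 -> lo Q i2 <= z <= hi Q i2 -> rect_set Q (pt x y z).
  move=> QD hx hy hz j; have [/is3P[->|->|->]|j3] := boolP (is3 j).
  - by rewrite pt0.
  - by rewrite pt1.
  - by rewrite pt2.
  by rewrite ptw //; have /andP[? ?] := Dw _ _ QD j3; rewrite !ltW.
have int_pt x y z : lo A i0 < x < hi A i0 -> lo A i1 < y < hi A i1 ->
    lo A i2 < z < hi A i2 -> rect_int A (pt x y z).
  move=> hx hy hz j; have [/is3P[->|->|->]|j3] := boolP (is3 j).
  - by rewrite pt0.
  - by rewrite pt1.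
  - by rewrite pt2.
  by rewrite ptw //; case: (wP j).
have besideD x y z sx sy sz :
    lo A i0 < x < hi A i0 -> lo A i1 < y < hi A i1 -> lo A i2 < z < hi A i2 ->
    exists t : D, [/\ beside sx (lo (val t) i0) (hi (val t) i0) x,
      beside sy (lo (val t) i1) (hi (val t) i1) y
    & beside sz (lo (val t) i2) (hi (val t) i2) z].
  move=> hx hy hz.
  pose s j := if j == i0 then sx else if j == i1 then sy else
              if j == i2 then sz else true.
  have Apt := int_pt x y z hx hy hz.
  have ptA : rect_set A (pt x y z).
    by move=> j; have /andP[? ?] := Apt j; rewrite !ltW.
  have [e e0 inA] : exists2 e, 0 < e &
      forall d, 0 < d < e -> rect_int A (nudge (pt x y z) s d).
    by apply: nudge_int => // j _; have /andP[] := Apt j.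
  have [e' e'0|Q QP Qs] := @rect_beside_cover R n P (pt x y z) s.
    have [d /andP[d0 de] _] : exists2 d, 0 < d < Num.min e e' & d \notin [::].
      by apply: ex_avoid; rewrite lt_min e0.
    move: de; rewrite lt_min => /andP[de de'].
    have Ad : rect_int A (nudge (pt x y z) s d) by apply: inA; rewrite d0.
    have : rect_set A (nudge (pt x y z) s d).
      by move=> j; have /andP[? ?] := Ad j; rewrite !ltW.
    rewrite -covP => -[Q QP Qx]; exists d, Q; split=> //.
    by rewrite d0.
  have QD : Q \in D.
    rewrite !inE QP; apply/forallP => j; have [//|j3] := boolP (is3 j).
    have := Qs j; rewrite ptw // /s; move: (j3).
    rewrite /is3 !inE !negb_or => /and3P[/negPf -> /negPf -> /negPf ->] /=.
    rewrite le_eqVlt => /andP[/orP[/eqP e2|->//] _].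
    by have [_] := wP j; rewrite -e2 loE.
  exists [` QD]; have := (Qs i0, Qs i1, Qs i2).
  rewrite pt0 pt1 pt2 /s eqxx eq_sym (negPf i01) eqxx.
  rewrite (eq_sym i2) (negPf i02) (eq_sym i2) (negPf i12) eqxx.
  by case=> -[? ?] ?.
have overlapD (t u : D) :
    lo (val t) i0 < hi (val u) i0 -> lo (val u) i0 < hi (val t) i0 ->
    lo (val t) i1 < hi (val u) i1 -> lo (val u) i1 < hi (val t) i1 ->
    lo (val t) i2 < hi (val u) i2 -> lo (val u) i2 < hi (val t) i2 -> t = u.
  move=> *; apply: val_inj; apply: contrapT => tu.
  have := disjP _ _ (DP _ (valP t)) (DP _ (valP u)) tu.
  apply/eqP/set0P; apply: rect_int_meet => j.
  have [/is3P[->|->|->] //|j3] := boolP (is3 j).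
  have /andP[? ?] := Dw _ _ (valP t) j3; have /andP[? ?] := Dw _ _ (valP u) j3.
  by split; lra.
have le4D x y z (s : seq D) :
    lo A i0 < x < hi A i0 -> lo A i1 < y < hi A i1 -> lo A i2 < z < hi A i2 ->
    uniq s -> (forall t, t \in s -> [/\ lo (val t) i0 <= x <= hi (val t) i0,
      lo (val t) i1 <= y <= hi (val t) i1 & lo (val t) i2 <= z <= hi (val t) i2]) ->
    (size s <= 4)%N.
  move=> hx hy hz us st.
  have -> : size s = size (map val s) by rewrite size_map.
  apply: leq_trans (_ : nu P (pt x y z) <= _)%N.
    rewrite /nu.
    apply: uniq_leq_size; first by rewrite map_inj_uniq //; apply: val_inj.
    move=> _ /mapP[t ts ->]; rewrite !inE (DP _ (valP t)).
    by apply/asboolP; have [? ? ?] := st t ts; apply: pt_in (valP t) _ _ _.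
  rewrite minP; last exact: int_pt.
  rewrite addn1 ltnS /beta.
  apply: leq_trans (_ : #|[:: i0; i1; i2]| <= 3)%N; last exact: card_size.
  apply: subset_leq_card; apply/fintype.subsetP => j /asboolP.
  move=> [Q [QP _ Qj]]; apply: contraT => j3; rewrite ptw // in Qj.
  by case: (wP j) => _; case: Qj => ->; rewrite ?loE ?hiE.
pose F := @BrickFamily R D (fun t => lo (val t) i0) (fun t => hi (val t) i0)
  (fun t => lo (val t) i1) (fun t => hi (val t) i1)
  (fun t => lo (val t) i2) (fun t => hi (val t) i2)
  (lo A i0) (hi A i0) (lo A i1) (hi A i1) (lo A i2) (hi A i2)
  (fun t => And3 (lo_lt_hi _ _) (lo_lt_hi _ _) (lo_lt_hi _ _))
  (fun t => And3 (subP _ (DP _ (valP t)) i0) (subP _ (DP _ (valP t)) i1)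
                 (subP _ (DP _ (valP t)) i2))
  besideD overlapD le4D.
exists F; split=> // Q QP full.
have QD : Q \in D.
  rewrite !inE QP; apply/forallP => j; have [//|j3] := boolP (is3 j).
  by have [-> ->] := full j j3; case: (wP j) => ->.
by exists ([` QD] : F).
Qed.

Lemma rect_disjoint (R : realType) n (Q1 Q2 : rectangle R n) i :
  hi Q1 i < lo Q2 i -> rect_set Q1 `&` rect_set Q2 = set0.
Proof.
move=> lt12; rewrite -subset0 => x [/(_ i) /andP[_ x1] /(_ i) /andP[x2 _]].
by have := le_lt_trans (le_trans x2 x1) lt12; rewrite ltxx.
Qed.

(** The subrectangle of A given by relative coordinates: 0 and 1 stand for the
    lower and upper ends of A, also in the directions beyond the end of the
    lists. *)
Lemma ex_rod (R : realType) n (A : rectangle R n) (l h : seq R) :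
  (forall k, 0 <= nth 0 l k /\ nth 0 l k < nth 1 h k <= 1) ->
  exists Q : rectangle R n, rect_set Q `<=` rect_set A /\
    forall i, lo Q i = lo A i + (hi A i - lo A i) * nth 0 l i /\
              hi Q i = lo A i + (hi A i - lo A i) * nth 1 h i.
Proof.
move=> lh.
have lt_lh (i : 'I_n) : lo A i + (hi A i - lo A i) * nth 0 l i <
               lo A i + (hi A i - lo A i) * nth 1 h i.
  rewrite ltrD2l ltr_pM2l ?subr_gt0 ?lo_lt_hi //.
  by have [_ /andP[]] := lh i.
exists (box lt_lh); split=> [x Qx i|i]; last by rewrite lo_box hi_box.
have := Qx i; rewrite lo_box hi_box; have := lo_lt_hi A i.
have [] := lh i.
move: (nth 0 l i) (nth 1 h i) => a b a0 /andP[ab b1] ltA /andP[ax xb].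
by apply/andP; split; nra.
Qed.

Lemma rods_not_minimal (R : realType) n (A : rectangle R n) : (3 <= n)%N ->
  exists S : {fset rectangle R n}, disjoint_subrectangles A S /\
    ~ (exists P : {fset rectangle R n}, minimal_partition A P /\ fsubset S P).
Proof.
move=> n3.
have [n0 n1] : (0 < n)%N /\ (1 < n)%N by rewrite !(leq_trans _ n3).
pose i0 := Ordinal n0; pose i1 := Ordinal n1; pose i2 := Ordinal n3.
have [|X [XA Xe]] := @ex_rod R n A [:: 0; 1 / 5; 1 / 5] [:: 1; 2 / 5; 2 / 5].
  by case=> [|[|[|k]]] /=; rewrite ?nth_nil; split; lra.
have [|Y [YA Ye]] := @ex_rod R n A [:: 1 / 5; 0; 3 / 5] [:: 2 / 5; 1; 4 / 5].
  by case=> [|[|[|k]]] /=; rewrite ?nth_nil; split; lra.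
have [|Z [ZA Ze]] := @ex_rod R n A [:: 3 / 5; 3 / 5; 0] [:: 4 / 5; 4 / 5; 1].
  by case=> [|[|[|k]]] /=; rewrite ?nth_nil; split; lra.
have := (lo_lt_hi A i0, lo_lt_hi A i1, lo_lt_hi A i2) => -[[A0 A1] A2].
have XY : rect_set X `&` rect_set Y = set0.
  by apply: (@rect_disjoint _ _ _ _ i2); rewrite (Xe i2).2 (Ye i2).1 /=; lra.
have XZ : rect_set X `&` rect_set Z = set0.
  by apply: (@rect_disjoint _ _ _ _ i1); rewrite (Xe i1).2 (Ze i1).1 /=; lra.
have YZ : rect_set Y `&` rect_set Z = set0.
  by apply: (@rect_disjoint _ _ _ _ i0); rewrite (Ye i0).2 (Ze i0).1 /=; lra.
have inS := @in_fset3 _ X Y Z.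
have YX : rect_set Y `&` rect_set X = set0 by rewrite setIC.
have ZX : rect_set Z `&` rect_set X = set0 by rewrite setIC.
have ZY : rect_set Z `&` rect_set Y = set0 by rewrite setIC.
exists [fset X; Y; Z]; split.
  split=> [Q /inS[] -> |Q1 Q2 /inS[] -> /inS[] -> ne];
    first [assumption|case: (ne erefl)].
have [SX SY SZ] := fset3_in X Y Z.
move=> [P [minP /fsubsetP SP]].
have [F [[x1 x2] [y1 y2] [z1 z2] rod]] :=
  @slice_bricks R n i0 i1 i2 A P isT isT isT minP.
have full (l h : seq R) (Q : rectangle R n) :
    (forall i, lo Q i = lo A i + (hi A i - lo A i) * nth 0 l i /\
              hi Q i = lo A i + (hi A i - lo A i) * nth 1 h i) ->
    size l = 3 -> size h = 3 ->
    forall j, j \notin [:: i0; i1; i2] -> lo Q j = lo A j /\ hi Q j = hi A j.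
  move=> Qe sl sh j; have [-> ->] := Qe j.
  rewrite !inE -!val_eqE !negb_or /= => j3.
  have j_ge : (3 <= j)%N by case: (val j) j3 => [|[|[|k]]].
  by rewrite !nth_default ?sl ?sh //; split; lra.
have [tX [[a1 a2] [a3 a4] [a5 a6]]] := rod X (SP _ SX) (full _ _ _ Xe erefl erefl).
have [tY [[b1 b2] [b3 b4] [b5 b6]]] := rod Y (SP _ SY) (full _ _ _ Ye erefl erefl).
have [tZ [[c1 c2] [c3 c4] [c5 c6]]] := rod Z (SP _ SZ) (full _ _ _ Ze erefl erefl).
apply: (@rods_false R F tX tY tZ).
- by rewrite a1 x1 (Xe i0).1 mulr0 addr0.
- by rewrite a2 x2 (Xe i0).2 mulr1 addrC subrK.
- by rewrite b3 y1 (Ye i1).1 mulr0 addr0.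
- by rewrite b4 y2 (Ye i1).2 mulr1 addrC subrK.
- by rewrite c5 z1 (Ze i2).1 mulr0 addr0.
- by rewrite c6 z2 (Ze i2).2 mulr1 addrC subrK.
- by rewrite a4 c3 (Xe i1).2 (Ze i1).1 /= lerD2l ler_pM2l ?subr_gt0 //; lra.
- by rewrite a6 b5 (Xe i2).2 (Ye i2).1 /= lerD2l ler_pM2l ?subr_gt0 //; lra.
Qed.

(** * Filling up in the plane *)

Section Planar.
Variable R : realType.
Implicit Types (A Q : rectangle R 2) (P S : {fset rectangle R 2}).

Notation X := (ord0 : 'I_2).
Notation Y := (ord_max : 'I_2).

Lemma ord2P (i j k : 'I_2) : i != j -> k = i \/ k = j.
Proof.
move: i j k => [[|[|//]] hi] [[|[|//]] hj] [[|[|//]] hk] // _;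
  by [left; apply: val_inj|right; apply: val_inj].
Qed.

Lemma card_pred2 (i j : 'I_2) (f : 'I_2 -> bool) : i != j ->
  #|[pred k | f k]| = (f i + f j)%N.
Proof.
move=> ij; rewrite -sum1_card big_mkcond (bigD1 i) //= (bigD1 j) 1?eq_sym //=.
rewrite big1 => [|k /andP[ki kj]]; last first.
  by have [e|e] := ord2P k ij; rewrite e eqxx in ki kj.
by rewrite addn0 !inE; case: (f i); case: (f j).
Qed.

(** A partition such that every interior point is, in some coordinate, strictly
    inside the range of a member that contains it, is minimal. Such a member t
    fills the two quadrants on one side of the point, so that the number of
    members at the point depends only on whether t fills all quadrants and on
    whether the two opposite quadrants belong to the same member u = u'. *)
Lemma minimal_criterion A P :
  (forall Q, Q \in P -> rect_set Q `<=` rect_set A) ->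
  (forall Q1 Q2, Q1 \in P -> Q2 \in P -> Q1 <> Q2 ->
     rect_int Q1 `&` rect_int Q2 = set0) ->
  (forall p (s : 'I_2 -> bool), rect_set A p -> (forall i, s i -> p ord0 i < hi A i) ->
     (forall i, ~~ s i -> lo A i < p ord0 i) ->
     exists2 Q, Q \in P & rect_beside Q p s) ->
  (forall p, rect_int A p -> exists Q i,
     [/\ Q \in P, rect_set Q p & lo Q i < p ord0 i < hi Q i]) ->
  minimal_partition A P.
Proof.
move=> subP disjP covP noX; split.
  split=> //; apply/seteqP; split=> [x [Q /= QP Qx]|x Ax]; first exact: subP Qx.
  pose s i := x ord0 i < hi A i.
  have [i /= //|i sF|Q QP /rect_besideW Qx] := covP x s Ax; last by exists Q.
  rewrite -leNgt in sF; exact: lt_le_trans (lo_lt_hi A i) sF.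
move=> p Ap.
have ApW : rect_set A p by move=> i; have /andP[? ?] := Ap i; rewrite !ltW.
have cov s : exists2 Q, Q \in P & rect_beside Q p s.
  by apply: covP => // i _; have /andP[] := Ap i.
have uniqP s Q1 Q2 : Q1 \in P -> Q2 \in P -> rect_beside Q1 p s ->
    rect_beside Q2 p s -> Q1 = Q2.
  move=> P1 P2 s1 s2; apply: contrapT => /(disjP _ _ P1 P2) /eqP.
  by apply/negP/set0P; apply: rect_beside_meet s1 s2.
have [t [i [tP tp ti]]] := noX p Ap.
have [j ij] : exists j : 'I_2, i != j.
  by case: i ti => [[|[|//]] hi] _; [exists ord_max|exists ord0].
pose sg a b k := if k == i then a else b : bool.
have sgE Q a b : beside a (lo Q i) (hi Q i) (p ord0 i) ->
    beside b (lo Q j) (hi Q j) (p ord0 j) -> rect_beside Q p (sg a b).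
  move=> ha hb k; rewrite /sg; have [->|->] := ord2P k ij.
    by rewrite eqxx.
  by rewrite eq_sym (negPf ij).
have sgI Q a b : rect_beside Q p (sg a b) ->
    beside a (lo Q i) (hi Q i) (p ord0 i) /\ beside b (lo Q j) (hi Q j) (p ord0 j).
  by move=> h; have := (h i, h j); rewrite /sg eqxx eq_sym (negPf ij) => -[].
have strict Q k b : lo Q k < p ord0 k < hi Q k ->
    beside b (lo Q k) (hi Q k) (p ord0 k).
  by case/andP=> h1 h2; case: b => /=; rewrite ?h1 ?h2 ?ltW.
have bvP k : reflect (boundary_vector P p k) `[< boundary_vector P p k >].
  exact: asboolP.
have not_strict Q k : rect_set Q p -> ~~ (lo Q k < p ord0 k < hi Q k) ->
    p ord0 k = lo Q k \/ p ord0 k = hi Q k.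
  move=> Qp; have /andP[] := Qp k; rewrite !le_eqVlt.
  by move=> /orP[/eqP ->|->]; [left|move=> /orP[/eqP ->|->]; [right|]].
have nbv k : (forall Q, Q \in P -> rect_set Q p -> lo Q k < p ord0 k < hi Q k) ->
    `[< boundary_vector P p k >] = false.
  move=> h; apply/bvP => -[Q [QP Qp Qk]]; have := h Q QP Qp.
  by case: Qk => ->; rewrite ltxx ?andbF.
have [s0 ts0] := rect_beside_ex tp.
pose b := s0 j; have tb : beside b (lo t j) (hi t j) (p ord0 j) := ts0 j.
have tiles Q : Q \in P -> rect_set Q p -> exists a c, rect_beside Q p (sg a c).
  by move=> QP /rect_beside_ex [s Qs]; exists (s i), (s j); apply: sgE.
have tilesb Q a : Q \in P -> rect_beside Q p (sg a b) -> Q = t.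
  by move=> QP Qs; apply: uniqP Qs _ => //; apply: sgE => //; apply: strict.
rewrite /beta (card_pred2 _ ij) /nu.
have [tj|tj] := boolP (lo t j < p ord0 j < hi t j).
  have tonly Q : Q \in P -> rect_set Q p -> Q = t.
    move=> QP Qp; have [a [c Qs]] := tiles Q QP Qp.
    by apply: uniqP Qs _ => //; apply: sgE; apply: strict.
  rewrite !nbv; try by move=> Q QP Qp; rewrite (tonly Q).
  rewrite (@fset_filter_eq _ _ [fset t]%fset) => [|Q QP /asboolP|Q].
  - by rewrite cardfs1.
  - by move=> Qp; rewrite (tonly Q QP Qp) fset11.
  by rewrite in_fset1 => /eqP ->; split=> //; apply/asboolP.
have bvj : `[< boundary_vector P p j >].
  by apply/asboolP; exists t; split=> //; apply: not_strict.
have [u uP us] := cov (sg true (~~ b)); have [u' u'P us'] := cov (sg false (~~ b)).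
have tnot Q a : rect_beside Q p (sg a (~~ b)) -> t != Q.
  move=> /sgI[_ Qj]; apply: contraNneq tj => e; rewrite -{}e in Qj.
  exact: beside_both Qj tb.
have tilesN Q : Q \in P -> rect_set Q p -> [\/ Q = t, Q = u | Q = u'].
  move=> QP Qp; have [a [c Qs]] := tiles Q QP Qp.
  have [e|ne] := eqVneq c b; first by rewrite e in Qs; apply: Or31; apply: tilesb Qs.
  have e : c = ~~ b by case: (c) (b) ne => [] [].
  rewrite {}e in Qs; case: a Qs => Qs; first by apply: Or32; apply: uniqP Qs us.
  by apply: Or33; apply: uniqP Qs us'.
have [up up'] := (rect_besideW us, rect_besideW us').
rewrite (@fset_filter_eq _ _ [fset t; u; u']%fset) => [|Q QP /asboolP Qp|Q]; last first.
- by case/in_fset3 => ->; split=> //; apply/asboolP.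
- by have [? ? ?] := fset3_in t u u'; case: (tilesN Q QP Qp) => ->.
rewrite (card_fset3 (tnot u true us) (tnot u' false us')) bvj.
have [e|ne] := eqVneq u u'.
  rewrite -{}e in us' tilesN.
  have ui : lo u i < p ord0 i < hi u i.
    exact: (beside_both (s := true) (sgI _ _ _ us').1 (sgI _ _ _ us).1).
  rewrite nbv => [|Q QP Qp]; last by have [->|->|->] := tilesN Q QP Qp.
  by [].
suff -> : `[< boundary_vector P p i >] by [].
apply/asboolP; exists u; split=> //; apply: not_strict => //.
apply: contra ne => ui; apply/eqP.
by apply: uniqP us' => //; apply: sgE; [apply: strict|case: (sgI _ _ _ us)].
Qed.

Lemma finite_rectangles (A : rectangle R 2) (E : seq R) :
  exists G : {fset rectangle R 2},
    forall Q, (forall k, lo Q k \in E /\ hi Q k \in E) -> Q \in G.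
Proof.
pose K : finType := {ffun 'I_2 * bool -> 'I_(size E)}.
pose f (c : K) : rectangle R 2 := odflt A (insub
  (\row_k nth 0 E (c (k, false)), \row_k nth 0 E (c (k, true)))).
exists [fset f c | c in K] => Q QE.
have ltE kb : (index (if kb.2 then hi Q kb.1 else lo Q kb.1) E < size E)%N.
  by rewrite index_mem; case: (QE kb.1); case: ifP.
apply/imfsetP; exists [ffun kb => Ordinal (ltE kb)] => //=.
rewrite /f (_ : (_, _) = val Q) ?valK //.
rewrite /= [corners Q]surjective_pairing; congr pair; apply/rowP => k;
  by rewrite mxE ffunE /= nth_index //; case: (QE k).
Qed.

Variables (A : rectangle R 2) (S : {fset rectangle R 2}).
Hypothesis disjS : disjoint_subrectangles A S.

(** The coordinates of the faces orthogonal to k of A and of the members of S. *)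
Definition levels (k : 'I_2) : seq R :=
  [seq lo Q k | Q <- (A |` S)%fset] ++ [seq hi Q k | Q <- (A |` S)%fset].

Lemma levelsP k v : reflect
  (exists2 Q, Q \in (A |` S)%fset & v = lo Q k \/ v = hi Q k) (v \in levels k).
Proof.
rewrite mem_cat; apply: (iffP orP) => [[]/mapP[Q QS ->]|[Q QS [] ->]].
- by exists Q => //; left.
- by exists Q => //; right.
- by left; apply: map_f.
- by right; apply: map_f.
Qed.

Lemma A_levels k : lo A k \in levels k /\ hi A k \in levels k.
Proof. by split; apply/levelsP; exists A; rewrite ?fset1U1; auto. Qed.

Lemma S_levels s k : s \in S -> lo s k \in levels k /\ hi s k \in levels k.
Proof. by move=> sS; split; apply/levelsP; exists s; rewrite ?fset1Ur; auto. Qed.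

Definition overlap Q1 Q2 :=
  forall k, lo Q1 k < hi Q2 k /\ lo Q2 k < hi Q1 k.

(** The x range of s contains that of Q. *)
Definition spans s Q := lo s X <= lo Q X /\ hi Q X <= hi s X.

(** The vertically maximal free rectangles of the strips between consecutive
    vertical lines through the vertical sides of A and of the members of S: no
    such line meets the interior of Q, no member of S overlaps Q, and the bottom
    and top sides of Q are contained in those of A or in the top and bottom
    sides of members of S. *)
Definition filler Q : Prop :=
  [/\ rect_set Q `<=` rect_set A,
      forall k, lo Q k \in levels k /\ hi Q k \in levels k,
      forall v, v \in levels X -> ~~ (lo Q X < v < hi Q X),
      forall s, s \in S -> ~ overlap s Q &
      (lo Q Y = lo A Y \/ exists s, [/\ s \in S, spans s Q & hi s Y = lo Q Y]) /\
      (hi Q Y = hi A Y \/ exists s, [/\ s \in S, spans s Q & lo s Y = hi Q Y])].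

Lemma forall_ord2 (T : 'I_2 -> Prop) : T X -> T Y -> forall k, T k.
Proof. by move=> TX TY k; have [->|->] := @ord2P X Y k isT. Qed.

Lemma filler_nested Q1 Q2 : filler Q1 -> filler Q2 -> overlap Q1 Q2 ->
  forall k, lo Q2 k <= lo Q1 k /\ hi Q1 k <= hi Q2 k.
Proof.
move=> F1 F2 ov; have [[o1 o2] [o3 o4]] := (ov X, ov Y).
have [/rect_sub sub1 E1 adj1 no1 _] := F1.
have [_ E2 _ _ [bot2 top2]] := F2.
have [l2 h2] := E2 X; have [sl sh] := sub1 Y.
have ov1 s : s \in S -> spans s Q2 -> lo s Y < hi Q1 Y -> lo Q1 Y < hi s Y ->
    False.
  move=> sS [sl2 sh2] s1 s2; apply: (no1 s sS); apply: forall_ord2 => //.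
  by split; [exact: le_lt_trans o2|exact: lt_le_trans sh2].
apply: forall_ord2; split.
- by have := adj1 _ l2; rewrite o2 andbT -leNgt.
- by have := adj1 _ h2; rewrite o1 /= -leNgt.
- rewrite leNgt; apply/negP => lt12; case: bot2 => [e|[s [sS sp se]]].
    by rewrite e ltNge sl in lt12.
  apply: (ov1 s sS sp); last by rewrite se.
  by apply: lt_trans (lo_lt_hi s Y) _; rewrite se.
- rewrite leNgt; apply/negP => lt12; case: top2 => [e|[s [sS sp se]]].
    by rewrite e ltNge sh in lt12.
  apply: (ov1 s sS sp); first by rewrite se.
  by apply: lt_trans (lo_lt_hi s Y); rewrite se.
Qed.

Lemma filler_disjoint Q1 Q2 : filler Q1 -> filler Q2 -> overlap Q1 Q2 -> Q1 = Q2.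
Proof.
move=> F1 F2 ov; have ov' : overlap Q2 Q1 by move=> k; case: (ov k).
apply: rectangle_eq => k.
have [l12 h12] := filler_nested F1 F2 ov k.
have [l21 h21] := filler_nested F2 F1 ov' k.
by split; apply/eqP; rewrite eq_le ?l12 ?l21 ?h12 ?h21.
Qed.

Lemma S_eq s1 s2 p : s1 \in S -> s2 \in S -> rect_set s1 p -> rect_set s2 p ->
  s1 = s2.
Proof.
move=> S1 S2 p1 p2; apply: contrapT => /(disjS.2 s1 s2 S1 S2) /eqP.
by apply/negP/set0P; exists p.
Qed.

(** A point of the bottom or top side of a filler that is interior to A belongs to
    a member of S whose side contains that of the filler. *)
Lemma filler_edge Q p : filler Q -> rect_set Q p -> rect_int A p ->
  lo Q Y < p ord0 Y < hi Q Y \/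
  exists s, [/\ s \in S, rect_set s p & spans s Q].
Proof.
move=> [_ _ _ _ [bot top]] Qp Ap.
have /andP[Al Ah] := Ap Y; have /andP[Ql Qh] := Qp Y; have /andP[Xl Xh] := Qp X.
have edge s : s \in S -> spans s Q -> lo s Y <= p ord0 Y <= hi s Y ->
    exists s, [/\ s \in S, rect_set s p & spans s Q].
  move=> sS [sl sh] sy; exists s; split=> //; apply: forall_ord2 => //.
  by rewrite (le_trans sl Xl) (le_trans Xh sh).
have [e|lop] := eqVneq (lo Q Y) (p ord0 Y).
  right; case: bot => [e'|[s [sS sp se]]]; first by rewrite -e e' ltxx in Al.
  by apply: edge sp _ => //; rewrite -e -se lexx ltW // lo_lt_hi.
have [e|hip] := eqVneq (p ord0 Y) (hi Q Y).
  right; case: top => [e'|[s [sS sp se]]]; first by rewrite e e' ltxx in Ah.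
  by apply: edge sp _ => //; rewrite e -se lexx ltW // lo_lt_hi.
by left; rewrite !lt_neqAle lop hip Ql Qh.
Qed.

(** A point outside S that is on none of the lines considered is in the filler
    obtained by extending the point to its strip, and then up and down to the
    closest members of S. *)
Lemma filler_cover (q : 'rV[R]_2) : rect_int A q ->
  (forall k, q ord0 k \notin levels k) ->
  exists2 Q, Q \in S \/ filler Q & rect_set Q q.
Proof.
move=> Aq gen.
have [[s sS sq]|noS] := pselect (exists2 s, s \in S & rect_set s q).
  by exists s => //; left.
have gen' k v : v \in levels k -> v <> q ord0 k.
  by move=> vk e; have := gen k; rewrite -e vk.
have [AlX AhX] := A_levels X; have [AlY AhY] := A_levels Y.
have /andP[qX1 qX2] := Aq X; have /andP[qY1 qY2] := Aq Y.
have [u [uE uq umax]] := ex_maximal id (P := fun v => v < q ord0 X) AlX qX1.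
have [u' [uE' uq' umin]] := ex_minimal id (P := fun v => q ord0 X < v) AhX qX2.
pose above s := lo s X < q ord0 X < hi s X.
have [v [vE [vq vbot] vmax]] := ex_maximal id (P := fun v => v < q ord0 Y /\
  (v = lo A Y \/ exists s, [/\ s \in S, above s & hi s Y = v])) AlY
  (conj qY1 (or_introl erefl)).
have [v' [vE' [vq' vtop] vmin]] := ex_minimal id (P := fun v => q ord0 Y < v /\
  (v = hi A Y \/ exists s, [/\ s \in S, above s & lo s Y = v])) AhY
  (conj qY2 (or_introl erefl)).
have lt_box k : (if k == X then u else v) < (if k == X then u' else v') :> R.
  by case: ifP => _; [exact: lt_trans uq uq'|exact: lt_trans vq vq'].
pose Q := box lt_box.
have [lX hX] : lo Q X = u /\ hi Q X = u' by rewrite lo_box hi_box.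
have [lY hY] : lo Q Y = v /\ hi Q Y = v' by rewrite lo_box hi_box.
have Qq : rect_set Q q by apply: forall_ord2; rewrite ?lX ?hX ?lY ?hY !ltW.
have adj w : w \in levels X -> w <= u \/ u' <= w.
  move=> wE; have [wq|qw|e] := ltgtP w (q ord0 X).
  - by left; apply: umax.
  - by right; apply: umin.
  - by case: (gen' X w).
have adj_span s : s \in S -> lo s X < u' -> u < hi s X -> lo s X <= u /\ u' <= hi s X.
  move=> sS; have [sl sh] := S_levels X sS.
  by case: (adj _ sl) => [? _|]; case: (adj _ sh) => // *; lra.
have above_span s : s \in S -> above s -> spans s Q.
  move=> sS /andP[s1 s2]; rewrite /spans lX hX; apply: adj_span => //.
    exact: lt_trans s1 uq'.
  exact: lt_trans uq s2.
exists Q => //; right; split.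
- suff sub k : lo A k <= lo Q k /\ hi Q k <= hi A k.
    move=> x Qx k; have [? ?] := sub k; have /andP[? ?] := Qx k.
    by apply/andP; split; apply: le_trans; eauto.
  move: k; apply: forall_ord2; rewrite ?lX ?hX ?lY ?hY.
    by split; [apply: umax|apply: umin].
  by split; [apply: vmax|apply: vmin] => //; split=> //; left.
- by apply: forall_ord2; rewrite ?lX ?hX ?lY ?hY.
- by move=> w wE; rewrite lX hX; case: (adj w wE) => ?; apply/negP => /andP[? ?]; lra.
- move=> s sS ov; have [] := ov X; have [] := ov Y; rewrite lX hX lY hY.
  move=> o1 o2 o3 o4; have [su su'] := adj_span s sS o3 o4.
  have as_ : above s by rewrite /above (le_lt_trans su uq) (lt_le_trans uq' su').
  have [sl sh] := S_levels Y sS.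
  have [q1|q1|e] := ltgtP (lo s Y) (q ord0 Y); last by case: (gen' Y (lo s Y)).
    have [q2|q2|e] := ltgtP (hi s Y) (q ord0 Y); last by case: (gen' Y (hi s Y)).
      have : hi s Y <= v by apply: vmax => //; split=> //; right; exists s.
      by rewrite leNgt o2.
    apply: noS; exists s => //; case/andP: as_ => a1 a2.
    by apply: forall_ord2; rewrite !ltW.
  have : v' <= lo s Y by apply: vmin => //; split=> //; right; exists s.
  by rewrite leNgt o1.
- rewrite lY hY; split.
    by case: vbot => [->|[s [sS sa se]]]; [left|right; exists s; split; auto].
  by case: vtop => [->|[s [sS sa se]]]; [left|right; exists s; split; auto].
Qed.

Lemma partition_extends : exists P, minimal_partition A P /\ fsubset S P.
Proof.
have [G GP] := finite_rectangles A (levels X ++ levels Y).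
pose P := (S `|` [fset Q in G | `[< filler Q >]])%fset.
have inP Q : Q \in P <-> Q \in S \/ filler Q.
  rewrite in_fsetU in_fset_filter; split.
    by move=> /orP[|/andP[_ /asboolP]]; [left|right].
  move=> [->//|fQ]; apply/orP; right; apply/andP; split; last exact/asboolP.
  apply: GP; have [_ lev _ _ _] := fQ; apply: forall_ord2; rewrite !(mem_cat _ (levels X)).
    by case: (lev X) => -> ->.
  by case: (lev Y) => -> ->; rewrite !orbT.
exists P; split; last by apply/fsubsetP => s sS; apply/inP; left.
have covP p (s : 'I_2 -> bool) : rect_set A p ->
    (forall i, s i -> p ord0 i < hi A i) ->
    (forall i, ~~ s i -> lo A i < p ord0 i) ->
    exists2 Q, Q \in P & rect_beside Q p s.
  move=> Ap sT sF; have [e0 e00 inA] := nudge_int Ap sT sF.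
  apply: rect_beside_cover => e e_gt0.
  (* The distances d that move p onto a line through a side. *)
  pose bad := [seq v - p ord0 X | v <- levels X] ++ [seq p ord0 X - v | v <- levels X] ++
    [seq v - p ord0 Y | v <- levels Y] ++ [seq p ord0 Y - v | v <- levels Y].
  have [d /andP[d0 de] dbad] : exists2 d, 0 < d < Num.min e e0 & d \notin bad.
    by apply: ex_avoid; rewrite lt_min e_gt0.
  move: de; rewrite lt_min => /andP[de de0].
  have badP k v : v \in levels k -> d != v - p ord0 k /\ d != p ord0 k - v.
    have [->|->] := @ord2P X Y k isT => vk; split; apply: contraNneq dbad => ->;
      rewrite !mem_cat; apply/or4P;
      [apply: Or41|apply: Or42|apply: Or43|apply: Or44]; by apply/mapP; exists v.
  have [||Q QP Qd] := @filler_cover (nudge p s d).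
  - by apply: inA; rewrite d0.
  - move=> k; apply/negP => vk; have [b1 b2] := badP k _ vk; rewrite mxE in b1 b2.
    by case: (s k) b1 b2 => /= /eqP b1 /eqP b2; lra.
  - by exists d, Q; split=> //; [rewrite d0|apply/inP].
apply: minimal_criterion => //.
- by move=> Q /inP[/(disjS.1 Q)//|[]].
- move=> Q1 Q2 /inP Q1P /inP Q2P ne; apply/eqP/negP => /negP/set0P[x [x1 x2]].
  have ov : overlap Q1 Q2.
    move=> k; have /andP[? ?] := x1 k; have /andP[? ?] := x2 k.
    by split; apply: lt_trans (_ : x ord0 k < _).
  have ov' : overlap Q2 Q1 by move=> k; case: (ov k).
  case: Q1P Q2P => [S1|F1] [S2|F2].
  + by apply: ne; apply: (@S_eq _ _ x S1 S2) => k;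
      [have /andP[? ?] := x1 k|have /andP[? ?] := x2 k]; rewrite !ltW.
  + by case: F2 => _ _ _ /(_ _ S1).
  + by case: F1 => _ _ _ /(_ _ S2).
  + by apply: ne; apply: filler_disjoint.
- move=> p Ap; have ApW : rect_set A p by move=> i; have /andP[? ?] := Ap i; rewrite !ltW.
  have cov s : exists2 Q, Q \in P & rect_beside Q p s.
    by apply: covP => // i _; have /andP[] := Ap i.
  have [[s sS sp]|noS] := pselect (exists2 s, s \in S & rect_set s p); last first.
    have [Q QP /rect_besideW Qp] := cov (fun=> true).
    have [QS|F] := (inP Q).1 QP; first by case: noS; exists Q.
    have [Qy|[s [sS sp _]]] := filler_edge F Qp Ap; first by exists Q, Y.
    by case: noS; exists s.
  have sP : s \in P by apply/inP; left.
  have [sx|nsx] := boolP (lo s X < p ord0 X < hi s X); first by exists s, X.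
  (* The point p is on a vertical side of s: in the direction b away from s there
     is a filler, and it has p strictly inside its y range. *)
  pose b := p ord0 X == hi s X.
  have nsb : ~~ beside b (lo s X) (hi s X) (p ord0 X).
    rewrite /b; case: eqP => [->|ne] /=; first by rewrite ltxx andbF.
    apply: contra nsx => /andP[-> ple] /=; rewrite lt_neqAle ple andbT.
    exact/eqP.
  have [Q QP Qb] := cov (fun=> b); have Qp := rect_besideW Qb.
  have [QS|F] := (inP Q).1 QP.
    by have := Qb X; rewrite (S_eq QS sS Qp sp) (negPf nsb).
  have [Qy|[s' [sS' sp' [sl sh]]]] := filler_edge F Qp Ap; first by exists Q, Y.
  have e := S_eq sS' sS sp' sp; rewrite {}e in sl sh.
  case/negP: nsb; have := Qb X; case: (b) => /= /andP[h1 h2]; apply/andP; split.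
  + exact: le_trans sl h1.
  + exact: lt_le_trans h2 sh.
  + exact: le_lt_trans sl h1.
  + exact: le_trans h2 sh.
Qed.

End Planar.

Theorem theorem1p3 (R : realType) :
  (forall (A : rectangle R 2) (S : {fset rectangle R 2}),
     disjoint_subrectangles A S ->
     exists P : {fset rectangle R 2},
       minimal_partition A P /\ fsubset S P) /\
  (forall (n : nat) (A : rectangle R n), (3 <= n)%N ->
     exists S : {fset rectangle R n},
       disjoint_subrectangles A S /\
       ~ (exists P : {fset rectangle R n},
            minimal_partition A P /\ fsubset S P)).
Proof.
split=> [A S disjS|n A n3]; first exact: partition_extends.
exact: rods_not_minimal.
Qed.
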